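(* Let $n\in\{2,3\}$ and let $\Omega\subset\mathbb R^n$ be a domain of diameter $R$ that is star-shaped with respect to a ball of radius $\rho$. Let $C^*>0$ be a constant such that $$\|\mathbf v-\boldsymbol\Pi_{RM}\mathbf v\|_{0,\Omega}\le C^*\|\nabla_S\mathbf v\|_{-1,\Omega}\qquad\forall\,\mathbf v\in[L^2(\Omega)]^n,$$ and let $C_P>0$ be such that $\|f\|_{0,\Omega}\le C_PR\,|f|_{1,\Omega}$ for all $f\in H^1_0(\Omega)$. Define $\beta_0^*$ by $$ \beta_0^*\,R^{-1}:=\inf_{\mathbf v\in\widetilde{\mathbf V}\setminus\{0\}}\ \sup_{\boldsymbol\tau\in\widetilde{\boldsymbol\Sigma}\setminus\{0\}}\frac{(\nabla\cdot\boldsymbol\tau,\mathbf v)_{0,\Omega}}{\|\boldsymbol\tau\|_{\boldsymbol\Sigma}\,\|\mathbf v\|_{0,\Omega}}. $$ Then $$ \beta_0^*\ \ge\ (C^* )^{-1}\,(1+C_P^2)^{-\frac12}. $$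
   Context: Star-shaped with respect to a ball $B$: for every $x\in\Omega$, $y\in B$ the segment joining $x$ and $y$ lies in $\Omega$. $(\cdot,\cdot)_{0,\Omega}$ and $\|\cdot\|_{0,\Omega}$ are the $L^2(\Omega)$ inner product and norm; $|\cdot|_{1,\Omega}$ is the $H^1(\Omega)$ seminorm; same symbols for vector fields and tensors. $H^1_0(\Omega)$ is the closure of $\mathcal C_0^\infty(\Omega)$ in $H^1(\Omega)$. The norm $\|\cdot\|_{-1,\Omega}$ on $H^{-1}(\Omega)=[H^1_0(\Omega)]^*$ is $\sup_{v\in H^1_0(\Omega)\setminus\{0\}}\langle u,v\rangle/|v|_{1,\Omega}$, and similarly for tensor-valued distributions with test functions in $[H^1_0(\Omega)]^{n\times n}$. $\nabla_S\mathbf v=\frac12(\nabla\mathbf v+(\nabla\mathbf v)^T)$ (distributional). Rigid body motions: $RM(\Omega)=\{\boldsymbol\alpha+b\,(x_2,-x_1)^T:\boldsymbol\alpha\in\mathbb R^2,\ b\in\mathbb R\}$ if $n=2$, $RM(\Omega)=\{\boldsymbol\alpha+\boldsymbol\omega\times(x_1,x_2,x_3)^T:\boldsymbol\alpha,\boldsymbol\omega\in\mathbb R^3\}$ if $n=3$; $\boldsymbol\Pi_{RM}$ is the $L^2(\Omega)$ projection onto $RM(\Omega)$. $\boldsymbol\Sigma:=\{\boldsymbol\tau\in H(\mathrm{div},\Omega):\boldsymbol\tau\text{ is a symmetric } n\times n \text{ tensor}\}$ (i.e. $\boldsymbol\tau\in[L^2(\Omega)]^{n\times n}$ with row-wise divergence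 $\nabla\cdot\boldsymbol\tau\in[L^2(\Omega)]^n$), with norm $\|\boldsymbol\tau\|_{\boldsymbol\Sigma}^2:=\|\boldsymbol\tau\|_{0,\Omega}^2+R^2\|\nabla\cdot\boldsymbol\tau\|_{0,\Omega}^2$. $\widetilde{\boldsymbol\Sigma}:=\{\boldsymbol\tau\in\boldsymbol\Sigma:\langle\boldsymbol\tau\,\mathbf n,\mathbf w\rangle_{\partial\Omega}=0\ \ \forall\,\mathbf w\in[H^1(\Omega)]^n\}$, where $\mathbf n$ is the outward unit normal and the pairing is the usual normal-trace duality on $\partial\Omega$. $\widetilde{\mathbf V}:=\{\mathbf v\in[L^2(\Omega)]^n:\boldsymbol\Pi_{RM}\mathbf v=0\}$. *)

(* Defs.v *)
From HB Require Import structures.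
From mathcomp Require Import all_boot all_order all_algebra.
From mathcomp Require Import all_classical all_reals all_analysis.

Set Implicit Arguments.
Unset Strict Implicit.
Unset Printing Implicit Defensive.

Import Order.TTheory GRing.Theory Num.Theory.
Import numFieldNormedType.Exports.

Local Open Scope classical_set_scope.
Local Open Scope ring_scope.

(* The points of R^n are row vectors. Their sigma-algebra is generated by the
   coordinate maps, as the library does for n.-tuple T. *)
Fact measure_rV_display : measure_display -> measure_display.
Proof. exact. Qed.

Section measurable_rV.
Context {d} {T : sigmaRingType d} (n : nat).

Let coord (i : 'I_n) (x : 'rV[T]_n) : T := x ord0 i.

Let rV_set0 : g_sigma_preimage coord set0.
Proof. exact: sigma_algebra0. Qed.

Let rV_setC A : g_sigma_preimage coord A -> g_sigma_preimage coord (~` A).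
Proof. exact: sigma_algebraC. Qed.

Let rV_bigcup (F : (set 'rV[T]_n)^nat) :
  (forall i, g_sigma_preimage coord (F i)) ->
  g_sigma_preimage coord (\bigcup_i (F i)).
Proof. exact: sigma_algebra_bigcup. Qed.

HB.instance Definition _ := @isMeasurable.Build (measure_rV_display d)
  'rV[T]_n (g_sigma_preimage coord) rV_set0 rV_setC rV_bigcup.

End measurable_rV.

Lemma measurable_coord d (T : sigmaRingType d) n (i : 'I_n) :
  measurable_fun [set: 'rV[T]_n] (fun x => x ord0 i).
Proof.
move=> _ Y mY; rewrite setTI; apply: sub_sigma_algebra => /=.
rewrite -bigcup_seq/=; exists i => /=; first by rewrite mem_index_enum.
by exists Y => //; rewrite setTI.
Qed.

Lemma measurable_fun_rV d d' (T : measurableType d) (T' : measurableType d') n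
    (f : T -> 'rV[T']_n) :
  (forall i, measurable_fun setT (fun x => f x ord0 i)) ->
  measurable_fun setT f.
Proof.
move=> mf; apply: (@measurability _ _ _ _ _ _
  (\big[setU/set0]_(i < n) preimage_set_system setT
     (fun x : 'rV[T']_n => x ord0 i) measurable)) => //.
move=> _ [B + <-]; rewrite -bigcup_seq => -[i _ [A mA <-]].
by have := mf i measurableT _ mA; rewrite !setTI.
Qed.

Lemma measurable_rV_box d (T : measurableType d) n (A : 'I_n -> set T) :
  (forall i, measurable (A i)) ->
  measurable [set x : 'rV[T]_n | forall i, A i (x ord0 i)].
Proof.
move=> mA; rewrite [mkset _](_ : _ =
    \big[setI/setT]_(i < n) ((fun x : 'rV[T]_n => x ord0 i) @^-1` A i)).
  apply: bigsetI_measurable => i _; rewrite -[X in measurable X]setTI.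
  exact: measurable_coord.
rewrite -bigcap_seq; apply/seteqP; split=> x /= H i //=.
by apply: H; rewrite /= mem_index_enum.
Qed.

Section lebesgue_rV.
Context {R : realType}.

Definition rV_rcons n (p : 'rV[R]_n * measurableTypeR R) : 'rV[R]_n.+1 :=
  \row_i (if unlift ord_max i is Some j then p.1 ord0 j else p.2).

Lemma measurable_rV_rcons n : measurable_fun setT (@rV_rcons n).
Proof.
apply: measurable_fun_rV => i; rewrite /rV_rcons.
case: (unliftP ord_max i) => [j ij|ij].
  apply: (eq_measurable_fun
    (fun p : 'rV[R]_n * measurableTypeR R => p.1 ord0 j)).
    by move=> x _; rewrite mxE ij liftK.
  by apply: (measurableT_comp (measurable_coord j)).
apply: (eq_measurable_fun (fun p : 'rV[R]_n * measurableTypeR R => p.2)).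
  by move=> x _; rewrite mxE ij unlift_none.
exact: measurable_snd.
Qed.

(* n-dimensional Lebesgue measure: the n-fold product of lebesgue_measure,
   transported to row vectors; the long name is the measure structure of
   pushforward. *)
Fixpoint lebesgue_rV n : {measure set 'rV[R]_n -> \bar R} :=
  match n with
  | 0 => \d_ (0 : 'rV[R]_0)
  | m.+1 => measure_function_pushforward__canonical__measure_function_Measure
     (lebesgue_rV m \x @lebesgue_measure R)%E (@measurable_rV_rcons m)
  end.

Lemma lebesgue_rV_box n (A : 'I_n -> set (measurableTypeR R)) :
  (forall i, measurable (A i)) ->
  lebesgue_rV n [set x | forall i, A i (x ord0 i)] =
  (\prod_(i < n) lebesgue_measure (A i))%E.
Proof.
elim: n A => [|n IH] A mA.
  rewrite big_ord0 /= diracE mem_set// => -[]//.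
pose A' i := A (widen_ord (leqnSn n) i).
rewrite big_ord_recr/= -(IH A'); last by move=> i; exact: mA.
rewrite /pushforward -product_measure1E//=.
  congr product_measure1; apply/seteqP; split=> [[x t] H|[x t] [/= H1 H2] i].
    split=> [i|]; rewrite /=.
      have := H (widen_ord (leqnSn n) i); rewrite /rV_rcons mxE.
      have -> : widen_ord (leqnSn n) i = lift ord_max i.
        by apply: val_inj; rewrite /= /bump leqNgt ltn_ord.
      rewrite liftK /= /A'.
      suff -> : widen_ord (leqnSn n) i = lift ord_max i by [].
      by apply: val_inj; rewrite /= /bump leqNgt ltn_ord.
    by have := H ord_max; rewrite /rV_rcons mxE unlift_none.
  rewrite /rV_rcons mxE; case: unliftP => [j ->|->//] /=.
  suff -> : lift ord_max j = widen_ord (leqnSn n) j by exact: H1.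
  by apply: val_inj; rewrite /= /bump leqNgt ltn_ord.
apply: (@measurable_rV_box _ (R : measurableType _) n A') => i; exact: mA.
Qed.

End lebesgue_rV.

Section geometry.
Context {R : realType} {n : nat}.
Implicit Types (Omega B : set 'rV[R]_n).

Definition domain Omega := [/\ open Omega, connected Omega & Omega !=set0].

(* The library norm on 'rV[R]_n is the sup norm. *)
Definition enorm (x : 'rV[R]_n) : R := Num.sqrt (\sum_(i < n) x ord0 i ^+ 2).

Definition eball (c : 'rV[R]_n) (rho : R) : set 'rV[R]_n :=
  [set y | enorm (y - c) < rho].

Definition diameter Omega : \bar R :=
  ereal_sup [set (enorm (x - y))%:E | x in Omega & y in Omega].

Definition star_shaped Omega B :=
  forall x y, Omega x -> B y ->
  forall t : R, 0 <= t <= 1 -> Omega (x + t *: (y - x)).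

End geometry.

Section test_functions.
Context {R : realType} {n : nat}.
Implicit Types (Omega : set 'rV[R]_n) (f phi : 'rV[R]_n -> R).

Definition partial (k : 'I_n) f : 'rV[R]_n -> R := fun x => 'D_('e_k) f x.

Definition grad f : 'rV[R]_n -> 'rV[R]_n := fun x => \row_k partial k f x.

Definition smooth f :=
  forall (s : seq 'I_n) x, differentiable (foldr partial f s) x.

Definition test_function Omega phi :=
  smooth phi /\
  exists K, [/\ compact K, K `<=` Omega & forall x, ~ K x -> phi x = 0].

End test_functions.

(* Elements of L^2(Omega) are represented by functions on R^n of which only the
   values on Omega matter; an element is nonzero when its norm is nonzero. *)
Section L2.
Context {R : realType} {n : nat}.
Local Notation X := 'rV[R]_n.
Implicit Types (Omega : set X) (f g : X -> R).

Definition L2 Omega f :=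
  measurable_fun Omega f /\
  (@lebesgue_rV R n).-integrable Omega (fun x => (f x ^+ 2)%:E).

Definition ip Omega f g : R := \int[lebesgue_rV n]_(x in Omega) (f x * g x).

Definition norm0 Omega f : R := Num.sqrt (ip Omega f f).

(* Vector fields are the case p = 1, n x n tensors the case p = q = n. *)
Context {p q : nat}.
Implicit Types F G : X -> 'M[R]_(p, q).

Definition L2m Omega F := forall i j, L2 Omega (fun x => F x i j).

Definition ipm Omega F G : R :=
  \sum_(i < p) \sum_(j < q) ip Omega (fun x => F x i j) (fun x => G x i j).

Definition norm0m Omega F : R := Num.sqrt (ipm Omega F F).

End L2.

(* A weak derivative is unique only almost everywhere, so the Sobolev spaces
   are relations between a function and a representative of its derivative. *)
Section Sobolev.
Context {R : realType} {n : nat}.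
Local Notation X := 'rV[R]_n.
Implicit Types (Omega : set X) (f g psi : X -> R) (Df : X -> 'rV[R]_n).

Definition weak_partial Omega (k : 'I_n) f g :=
  forall psi, test_function Omega psi ->
  ip Omega f (partial k psi) = - ip Omega g psi.

(* f \in H^1(Omega) with weak gradient Df, so that |f|_1 = norm0m Omega Df *)
Definition H1 Omega f Df :=
  [/\ L2 Omega f, L2m Omega Df &
      forall k, weak_partial Omega k f (fun x => Df x ord0 k)].

Definition norm1 Omega f Df : R :=
  Num.sqrt (norm0 Omega f ^+ 2 + norm0m Omega Df ^+ 2).

Definition H10 Omega f Df :=
  H1 Omega f Df /\
  forall e : R, 0 < e -> exists2 psi, test_function Omega psi &
    norm1 Omega (f \- psi) (Df \- grad psi) < e.

(* Row i of the Jacobian matrix Dw is the weak gradient of the component w_i. *)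
Definition H1_vector Omega (w : X -> 'rV[R]_n) (Dw : X -> 'M[R]_n) :=
  forall i, H1 Omega (fun x => w x ord0 i) (fun x => row i (Dw x)).

(* Dphi i j is the weak gradient of the entry phi_ij. *)
Definition H10_tensor Omega (phi : X -> 'M[R]_n)
    (Dphi : 'I_n -> 'I_n -> X -> 'rV[R]_n) :=
  forall i j, H10 Omega (fun x => phi x i j) (Dphi i j).

Definition seminorm1_tensor Omega (Dphi : 'I_n -> 'I_n -> X -> 'rV[R]_n) : R :=
  Num.sqrt (\sum_(i < n) \sum_(j < n) norm0m Omega (Dphi i j) ^+ 2).

(* H^{-1} norm of a tensor-valued functional, given as a function of the test
   tensor and of its weak gradient *)
Definition norm_Hm1_tensor Omega
    (L : (X -> 'M[R]_n) -> ('I_n -> 'I_n -> X -> 'rV[R]_n) -> R) : \bar R :=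
  ereal_sup [set y | exists phi Dphi,
    [/\ H10_tensor Omega phi Dphi, norm0m Omega phi != 0 &
        y = (L phi Dphi / seminorm1_tensor Omega Dphi)%:E]].

(* The distribution d_k f, for f \in L^2(Omega), applied to an element of
   H^1_0(Omega) with weak gradient Dpsi: this is the continuous extension to
   H^1_0(Omega) of psi |-> - (f, d_k psi). *)
Definition dist_partial Omega (k : 'I_n) f (Dpsi : X -> 'rV[R]_n) : R :=
  - ip Omega f (fun x => Dpsi x ord0 k).

(* (nabla_S v)_ij = (d_j v_i + d_i v_j) / 2 *)
Definition sym_grad Omega (v : X -> 'rV[R]_n) (phi : X -> 'M[R]_n)
    (Dphi : 'I_n -> 'I_n -> X -> 'rV[R]_n) : R :=
  \sum_(i < n) \sum_(j < n) 2^-1 *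
    (dist_partial Omega j (fun x => v x ord0 i) (Dphi i j) +
     dist_partial Omega i (fun x => v x ord0 j) (Dphi i j)).

End Sobolev.

Section rigid_motions.
Context {R : realType}.

Definition RM2 : set ('rV[R]_2 -> 'rV[R]_2) :=
  [set r | exists (alpha : 'rV[R]_2) (b : R), forall x : 'rV[R]_2,
     r x = alpha + b *: \row_i [:: x ord0 1; - x ord0 0]`_i].

Definition cross (a b : 'rV[R]_3) : 'rV[R]_3 :=
  \row_i [:: a ord0 1 * b ord0 2 - a ord0 2 * b ord0 1;
             a ord0 2 * b ord0 0 - a ord0 0 * b ord0 2;
             a ord0 0 * b ord0 1 - a ord0 1 * b ord0 0]`_i.

Definition RM3 : set ('rV[R]_3 -> 'rV[R]_3) :=
  [set r | exists alpha omega : 'rV[R]_3, forall x : 'rV[R]_3,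
     r x = alpha + cross omega x].

(* Only n = 2 and n = 3 are meaningful. *)
Definition RM n : set ('rV[R]_n -> 'rV[R]_n) :=
  match n with 2 => RM2 | 3 => RM3 | _ => set0 end.

(* The L^2(Omega) projection of v onto RM(Omega) is r; it is a relation because
   existence and uniqueness of r are not part of the definition. *)
Definition is_proj_RM n (Omega : set 'rV[R]_n) (v r : 'rV[R]_n -> 'rV[R]_n) :=
  RM r /\ forall s, RM s -> ipm Omega (v \- r) s = 0.

End rigid_motions.

Section stress_spaces.
Context {R : realType} {n : nat}.
Local Notation X := 'rV[R]_n.
Implicit Types (Omega : set X) (tau : X -> 'M[R]_n) (d v w : X -> 'rV[R]_n).

Definition weak_div Omega tau d :=
  forall (i : 'I_n) psi, test_function Omega psi ->
  \sum_(j < n) ip Omega (fun x => tau x i j) (partial j psi) =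
  - ip Omega (fun x => d x ord0 i) psi.

(* tau \in Sigma with row-wise divergence d *)
Definition Sigma_space Omega tau d :=
  [/\ L2m Omega tau, L2m Omega d, weak_div Omega tau d &
      {ae lebesgue_rV n, forall x, Omega x -> (tau x)^T = tau x}].

(* ||tau||_Sigma, where diam is the diameter of Omega *)
Definition norm_Sigma Omega (diam : R) tau d : R :=
  Num.sqrt (norm0m Omega tau ^+ 2 + diam ^+ 2 * norm0m Omega d ^+ 2).

(* The duality <tau n, w> on the boundary, defined by Green's formula as
   (tau, nabla w) + (div tau, w) *)
Definition normal_trace Omega tau d w (Dw : X -> 'M[R]_n) : R :=
  ipm Omega tau Dw + ipm Omega d w.

Definition Sigma_tilde Omega tau d :=
  Sigma_space Omega tau d /\
  forall w Dw, H1_vector Omega w Dw -> normal_trace Omega tau d w Dw = 0.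

Definition V_tilde Omega v := L2m Omega v /\ is_proj_RM Omega v (fun=> 0).

Definition inf_sup Omega (diam : R) : \bar R :=
  ereal_inf [set z | exists v, [/\ V_tilde Omega v, norm0m Omega v != 0 &
    z = ereal_sup [set y | exists tau d,
      [/\ Sigma_tilde Omega tau d, norm0m Omega tau != 0 &
          y = (ipm Omega d v /
               (norm_Sigma Omega diam tau d * norm0m Omega v))%:E]]]].

End stress_spaces.

(* Main.v *)
Require Import Defs.
From HB Require Import structures.
From mathcomp Require Import all_boot all_order all_algebra.
From mathcomp Require Import all_classical all_reals all_analysis.
From mathcomp Require Import measurable_realfun ring lra.

(* Testing with tensors tau = - sym phi, phi in H^1_0, turns the H^{-1} norm of
   nabla_S v into a supremum of (div tau, v). Such tau is in Sigma-tilde, and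
   ||tau|| <= C_P R |phi|_1 by Poincare. The sharp bound ||div tau|| <= |tau|_1
   (without a dimensional constant) holds because
   (d_j tau_ij, d_k tau_ik) = (d_k tau_ij, d_j tau_ik) on H^1_0; by density of
   test functions and the definition of weak derivatives, this only requires
   the symmetry of second derivatives, not integration by parts. *)

Set Implicit Arguments.
Unset Strict Implicit.
Unset Printing Implicit Defensive.

Import Order.TTheory GRing.Theory Num.Theory.
Import numFieldNormedType.Exports.

Local Open Scope classical_set_scope.
Local Open Scope ring_scope.

(** * Smooth and test functions *)

(** The $H^{-1}$ norm in [hproj] is a supremum in the extended reals: it may be infinite and need
    not be attained, so no extremal test tensor is at hand. The final argument fixes a positive u
    strictly below the target constant, extracts one phi whose quotient exceeds the matching
    threshold, and lets u approach the target. The factor 1 + C_P^2 adds the squares of the two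
    bounds C_P R |phi|_1 for tau and R |phi|_1 for R div tau. Weak gradients are relations between
    representatives, and H^1_0 is known only through approximation. Three facts about it come from
    one principle, [H10_closure]: a functional (a, f) + sum_k (b_k, D_k f) with L^2 coefficients
    that vanishes on test functions vanishes on H^1_0. These are the exchange of derivatives, the
    zero normal trace, and the zero gradient of a null function. *)

Section calculus.
Context {R : realType} {n : nat}.
Local Notation X := 'rV[R]_n.
Implicit Types (f g : X -> R) (x v : X) (i j k : 'I_n).

Lemma is_derive_line f x v (t : R) : differentiable f (x + t *: v) ->
  is_derive t 1 (fun s => f (x + s *: v)) ('D_v f (x + t *: v)).
Proof.
move=> df.
have E : (fun h : R => h^-1 *: ((fun s : R => f (x + s *: v)) (h *: 1 + t) -
                        (fun s : R => f (x + s *: v)) t)) =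
         (fun h : R => h^-1 *: (f (h *: v + (x + t *: v)) - f (x + t *: v))).
  apply/funext => h /=; congr (_ *: (f _ - _)).
  by rewrite scalerDl addrCA [h *: 1]mulr1.
apply: DeriveDef.
  by have := diff_derivable (v := v) df; rewrite /derivable /= E.
by rewrite /derive /= E.
Qed.

Lemma smooth_differentiable f x : smooth f -> differentiable f x.
Proof. by move=> /(_ [::] x). Qed.

Lemma smooth_partial f k : smooth f -> smooth (partial k f).
Proof. by move=> sf s x; have := sf (rcons s k) x; rewrite foldr_rcons. Qed.

Lemma smooth_continuous f : smooth f -> continuous f.
Proof.
by move=> sf x; exact/differentiable_continuous/smooth_differentiable.
Qed.

Lemma MVT_line f x v (h : R) : smooth f -> 0 < h ->
  exists2 t, 0 < t < h & f (x + h *: v) - f x = 'D_v f (x + t *: v) * h.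
Proof.
move=> sf h0.
have D (t : R) : is_derive t 1 (fun s => f (x + s *: v)) ('D_v f (x + t *: v)).
  exact/is_derive_line/smooth_differentiable.
have [|t th E] := MVT h0 (fun t _ => D t).
  by apply: derivable_within_continuous => t _; exact: ex_derive.
exists t; first by move: th; rewrite in_itv.
by move: E; rewrite scale0r addr0 subr0.
Qed.

Lemma partialD f g k : smooth f -> smooth g ->
  partial k (f \+ g) = partial k f \+ partial k g.
Proof.
move=> sf sg; apply/funext => x; rewrite /partial deriveD//;
  exact/diff_derivable/smooth_differentiable.
Qed.

Lemma partialZ (a : R) f k : smooth f ->
  partial k (fun x => a * f x) = (fun x => a * partial k f x).
Proof.
move=> sf; apply/funext => x.
rewrite /partial -[LHS]/('D__ (a \*: f) x) deriveZ//.
exact/diff_derivable/smooth_differentiable.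
Qed.

Lemma foldr_partialD f g s : smooth f -> smooth g ->
  foldr partial (f \+ g) s = foldr partial f s \+ foldr partial g s.
Proof.
elim/last_ind: s f g => [//|s k IH] f g sf sg.
by rewrite !foldr_rcons partialD// IH//; exact: smooth_partial.
Qed.

Lemma foldr_partialZ (a : R) f s : smooth f ->
  foldr partial (fun x => a * f x) s = (fun x => a * foldr partial f s x).
Proof.
elim/last_ind: s f => [//|s k IH] f sf.
by rewrite !foldr_rcons partialZ// IH//; exact: smooth_partial.
Qed.

Lemma smoothD f g : smooth f -> smooth g -> smooth (f \+ g).
Proof.
move=> sf sg s x; rewrite foldr_partialD//.
by apply: differentiableD; [exact: sf|exact: sg].
Qed.

Lemma smoothZ (a : R) f : smooth f -> smooth (fun x => a * f x).
Proof.
move=> sf s x; rewrite foldr_partialZ//.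
exact: differentiableZ (sf s x).
Qed.

(** The mean value theorem is applied twice, along e_i to the difference of two parallel lines, then
    along e_j. The left side is symmetric in i and j, while the right side fixes an order of
    differentiation. *)
Lemma second_difference f x i j (h : R) : smooth f -> 0 < h ->
  exists st : R * R, [/\ 0 < st.1 < h, 0 < st.2 < h &
    f (x + h *: 'e_i + h *: 'e_j) - f (x + h *: 'e_i) -
      f (x + h *: 'e_j) + f x =
    partial j (partial i f) (x + st.1 *: 'e_i + st.2 *: 'e_j) * h * h].
Proof.
move=> sf h0.
have D y (t : R) : is_derive t 1 (fun s => f (y + s *: 'e_i))
    (partial i f (y + t *: 'e_i)).
  exact/is_derive_line/smooth_differentiable.
pose g (s : R) := f (x + h *: 'e_j + s *: 'e_i) - f (x + s *: 'e_i).
have Dg (t : R) : is_derive t 1 g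
    (partial i f (x + h *: 'e_j + t *: 'e_i) - partial i f (x + t *: 'e_i)).
  exact: (is_deriveB (D (x + h *: 'e_j) t) (D x t)).
have [|s sh E] := MVT h0 (fun t _ => Dg t).
  by apply: derivable_within_continuous => t _; exact: ex_derive.
have [t th E'] := MVT_line (x + s *: 'e_i) 'e_j (smooth_partial i sf) h0.
exists (s, t); split=> /=; [by move: sh; rewrite in_itv|exact: th|].
move: E; rewrite /g scale0r !addr0 subr0 [x + _ + s *: _]addrAC {}E'.
rewrite [x + h *: 'e_j + _]addrAC -/(partial j (partial i f)) => <-; ring.
Qed.

(** Both mixed derivatives, at two points near x, equal the same second difference divided by h^2;
    continuity at x then makes their values at x arbitrarily close. *)
Lemma partialC f i j : smooth f ->
  partial i (partial j f) = partial j (partial i f).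
Proof.
move=> sf; apply/funext => x; apply/eqP; rewrite -subr_eq0 -normr_eq0.
apply/eqP/le_anti; rewrite normr_ge0 andbT.
apply/ler_addgt0Pr => e e0; rewrite add0r.
have e2 : 0 < e / 2 by rewrite divr_gt0.
have key (A B C : R) : `|A - C| < e / 2 -> `|B - C| < e / 2 -> `|A - B| <= e.
  rewrite [`|B - C|]distrC => /ltW AC /ltW CB.
  by rewrite (le_trans (ler_distD C _ _))// [e]splitr lerD.
have c k l : \forall y \near x,
    `|partial k (partial l f) x - partial k (partial l f) y| < e / 2.
  have /smooth_continuous := smooth_partial k (smooth_partial l sf).
  move=> /(_ x) /cvgrPdist_lt/(_ _ e2).
  exact.
have /nbhs_ballP[d d0 H] : \forall y \near x,
   `|partial i (partial j f) x - partial i (partial j f) y| < e / 2 /\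
   `|partial j (partial i f) x - partial j (partial i f) y| < e / 2.
  by apply: filterI; exact: c.
(* Balls are those of the sup norm, in which a basis vector has norm at most 1; two steps shorter
   than d / 3 stay inside. *)
have bd (k l : 'I_n) (s t : R) : 0 < s < d / 3 -> 0 < t < d / 3 ->
    ball x d (x + s *: 'e_k + t *: 'e_l).
  move=> /andP[s0 sd] /andP[t0 td]; rewrite -ball_normE /ball_/=.
  rewrite -addrA opprD addrA subrr add0r normrN.
  apply: le_lt_trans (ler_normD _ _) _; rewrite !normrZ !gtr0_norm//.
  have ne (m : 'I_n) : `|'e_m : X| <= 1.
    rewrite [leLHS]/Num.norm /= mx_normrE; apply/bigmax_leP.
    split => // -[a b] _.
    by rewrite mxE /=; case: (_ && _); rewrite /= ?normr1 ?normr0.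
  have := ler_wpM2l (ltW s0) (ne k); have := ler_wpM2l (ltW t0) (ne l).
  by rewrite !mulr1; have := d0 : 0 < d; lra.
have d3 : 0 < d / 3 by rewrite divr_gt0.
have [h h0 hd] : exists2 h : R, 0 < h & h < d / 3.
  by exists (d / 3 / 2); [rewrite divr_gt0|have := d3; lra].
have lth (s : R) : 0 < s < h -> 0 < s < d / 3.
  by move=> /andP[-> /lt_trans]; exact.
have [[s t] /= [/lth sh /lth th E]] := second_difference x i j sf h0.
have [[s' t'] /= [/lth sh' /lth th' E']] := second_difference x j i sf h0.
have [_ +] := H _ (bd i j _ _ sh th).
have [+ _] := H _ (bd j i _ _ sh' th').
have -> : partial i (partial j f) (x + s' *: 'e_j + t' *: 'e_i) =
          partial j (partial i f) (x + s *: 'e_i + t *: 'e_j).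
  apply: (mulIf (lt0r_neq0 h0)); apply: (mulIf (lt0r_neq0 h0)).
  refine (etrans (esym E') (etrans _ E)).
  rewrite [x + h *: 'e_j + _]addrAC; ring.
exact: key.
Qed.

End calculus.

Section test_functions.
Context {R : realType} {n : nat}.
Local Notation X := 'rV[R]_n.
Implicit Types (Omega : set X) (psi phi : X -> R).

Lemma test_functionD Omega psi phi : test_function Omega psi ->
  test_function Omega phi -> test_function Omega (psi \+ phi).
Proof.
move=> [s [K [cK KO K0]]] [s' [K' [cK' KO' K0']]]; split; first exact: smoothD.
exists (K `|` K'); split; first exact: compactU.
- by rewrite subUset.
- by move=> x /not_orP[xK xK']; rewrite /= K0// K0'// addr0.
Qed.

Lemma test_functionZ Omega (a : R) psi : test_function Omega psi ->
  test_function Omega (fun x => a * psi x).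
Proof.
move=> [s [K [cK KO K0]]]; split; first exact: smoothZ.
by exists K; split=> // x /K0 ->; rewrite mulr0.
Qed.

(** The same compact set serves: its complement is open, so psi vanishes near each of its points. *)
Lemma test_function_partial Omega k psi : test_function Omega psi ->
  test_function Omega (partial k psi).
Proof.
move=> [s [K [cK KO K0]]]; split; first exact: smooth_partial.
exists K; split=> // x xK; rewrite /partial.
rewrite (@near_eq_derive _ _ _ _ (cst 0)) ?derive_cst//.
have oK : open (~` K) by exact/closed_openC/(compact_closed (@norm_hausdorff _ _) cK).
have : nbhs x (~` K) by exact: open_nbhs_nbhs.
by apply: filterS => y /K0.
Qed.

End test_functions.

(** * Measurability in R^n *)

Section measurability.
Context {R : realType} {n : nat}.
Local Notation X := 'rV[R]_n.
Local Notation mu := (@lebesgue_rV R n).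
Implicit Types (Omega A : set X) (f g psi : X -> R).

(** The sigma-algebra is generated by coordinates, so A is written as a countable union of boxes
    with rational centre and radius; a box not contained in A is replaced by the empty set. *)
Lemma open_measurable_rV A : open A -> measurable A.
Proof.
move=> oA.
pose box (p : 'rV[rat]_n * rat) : set X :=
  [set x | forall i, `|ratr (p.1 ord0 i) - x ord0 i| < ratr p.2].
pose F p := if `[< box p `<=` A >] then box p else set0.
have -> : A = \bigcup_p F p.
  apply/seteqP; split => [x Ax|x [p _]]; last first.
    by rewrite /F; case: asboolP => // H /H.
  have /nbhs_ballP[e /= e0 xe] := open_nbhs_nbhs (conj oA Ax).
  (* A radius below e / 2 suffices because x and any y of the box are each that close to the
     rational centre. *)
  have e20 : 0 < e / 2 by rewrite divr_gt0.
  have [q] := rat_in_itvoo e20; rewrite in_itv /= => /andP[q0 qe].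
  have qi (i : 'I_n) : exists r : rat, `|ratr r - x ord0 i| < ratr q.
    have /rat_in_itvoo[r] : x ord0 i - ratr q < x ord0 i + ratr q.
      by rewrite ltrBlDr -addrA ltrDl addr_gt0.
    by rewrite in_itv/= => rq; exists r; rewrite ltr_distl.
  have [r rP] := choice qi.
  have bx : box (\row_i r i, q) x by move=> i; rewrite mxE; exact: rP.
  exists (\row_i r i, q) => //; rewrite /F; case: asboolP => // -[].
  move=> y by_; apply: xe; split => // a i; rewrite ord1.
  rewrite /ball /= (le_lt_trans (ler_distD (ratr (r i)) _ _))//.
  have := by_ i; have := bx i; rewrite /= !mxE [`|_ - x _ _|]distrC => h1 h2.
  by rewrite [e]splitr ltrD//; [exact: lt_trans h1 qe|exact: lt_trans h2 qe].
apply: countable_bigcupT_measurable => [|p]; first exact: countableP.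
rewrite /F; case: asboolP => // _.
apply: (@measurable_rV_box _ (measurableTypeR R) _
  (fun i => [set t : R | `|ratr (p.1 ord0 i) - t| < ratr p.2])) => i.
by apply: open_measurable; have := @ball_open R R (ratr (p.1 ord0 i)) (ratr p.2);
  rewrite -ball_normE.
Qed.

Lemma compact_measurable_rV A : compact A -> measurable A.
Proof.
move=> /compact_closed - /(_ (@norm_hausdorff _ _)) /closed_openC.
by move=> /open_measurable_rV /measurableC; rewrite setCK.
Qed.

Lemma continuous_measurable_rV f : continuous f -> measurable_fun setT f.
Proof.
move=> cf; apply: (measurability _ (RGenOpens.measurableE R)).
move=> _ [_ [a [b ->] <-]]; rewrite setTI; apply: open_measurable_rV.
move/continuousP: cf; apply; exact: interval_open.
Qed.

Lemma compact_finite_measure_rV A : compact A -> (mu A < +oo)%E.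
Proof.
move=> cA; have [M [_ HM]] := compact_bounded cA.
(* Boundedness provides estimates only by numbers strictly above M, hence M + 1. *)
have {}HM x : A x -> forall i, `|x ord0 i| <= M + 1.
  have M1 : M < M + 1 by rewrite ltrDl.
  move=> /(HM _ M1); rewrite {1}/Num.norm /= mx_normrE => /bigmax_leP[_ H] i.
  exact: (H (ord0, i)).
pose B (i : 'I_n) : set (measurableTypeR R) := `[- (M + 1), M + 1]%classic.
have mB i : measurable (B i) by exact: measurable_itv.
apply: (@le_lt_trans _ _ (mu [set x | forall i, B i (x ord0 i)])).
  apply: le_measure; rewrite ?inE.
  - exact: compact_measurable_rV.
  - exact: (@measurable_rV_box _ (measurableTypeR R)).
  - by move=> x /HM Ax i; rewrite /B /= in_itv /= -ler_norml.
rewrite lebesgue_rV_box//; rewrite ltey_eq prode_fin_num// => i _.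
by rewrite /B lebesgue_measure_itv /=; case: ifPn.
Qed.

End measurability.

(** * The space L^2 *)

Section L2_theory.
Context {R : realType} {n : nat}.
Local Notation X := 'rV[R]_n.
Local Notation mu := (@lebesgue_rV R n).
Variable Omega : set X.
Hypothesis mOmega : measurable Omega.
Implicit Types (f g h : X -> R).

(** The product is dominated by f^2 + g^2, as the squares of f + g and f - g are nonnegative. *)
Lemma L2_integrableM f g : L2 Omega f -> L2 Omega g ->
  mu.-integrable Omega (EFin \o (f \* g)).
Proof.
move=> [mf f2] [mg g2].
apply: (le_integrable mOmega _ _ (integrableD mOmega f2 g2)).
  exact/measurable_EFinP/measurable_funM.
move=> x _; rewrite lee_fin /= [leRHS]ger0_norm ?addr_ge0 ?sqr_ge0//.
rewrite ler_norml; have := sqr_ge0 (f x - g x); have := sqr_ge0 (f x + g x).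
have := sqr_ge0 (f x); have := sqr_ge0 (g x).
by rewrite sqrrB sqrrD => ? ? ? ?; apply/andP; split; lra.
Qed.

Lemma L2D f g : L2 Omega f -> L2 Omega g -> L2 Omega (f \+ g).
Proof.
move=> Lf Lg; have := L2_integrableM Lf Lg; case: Lf Lg => mf f2 [mg g2] fg.
split; first exact: measurable_funD.
have E : (fun x => ((f \+ g) x ^+ 2)%:E) =
    (fun x => (f x ^+ 2)%:E) \+ ((fun x => (g x ^+ 2)%:E) \+
      ((EFin \o (f \* g)) \+ (EFin \o (f \* g)))) :> (X -> \bar R).
  by apply/funext => x /=; rewrite -!EFinD; congr EFin; ring.
by rewrite E; do 2! apply: integrableD => //; exact: integrableD.
Qed.

Lemma L2Z (a : R) f : L2 Omega f -> L2 Omega (fun x => a * f x).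
Proof.
move=> [mf f2]; split; first exact: measurable_funM.
have -> : (fun x => ((a * f x) ^+ 2)%:E) =
    (fun x => ((a ^+ 2)%:E * (f x ^+ 2)%:E)%E).
  by apply/funext => x; rewrite -EFinM exprMn.
exact: integrableZl.
Qed.

Lemma L2B f g : L2 Omega f -> L2 Omega g -> L2 Omega (f \- g).
Proof.
move=> Lf Lg; have -> : f \- g = f \+ (fun x => -1 * g x).
  by apply/funext => x /=; rewrite mulN1r.
exact/L2D/L2Z.
Qed.

Lemma L2_sum (I : Type) (r : seq I) (P : pred I) (F : I -> X -> R) :
  (forall i, P i -> L2 Omega (F i)) ->
  L2 Omega (fun x => \sum_(i <- r | P i) F i x).
Proof.
move=> LF; have L0 : L2 Omega (fun=> 0).
  split; first exact: measurable_cst.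
  by rewrite expr0n; exact: integrable0.
elim: r => [|i r IH].
  by under eq_fun do rewrite big_nil.
under eq_fun do rewrite big_cons.
case Pi: (P i) => //; exact: (L2D (LF _ Pi)).
Qed.

Lemma ipC f g : ip Omega f g = ip Omega g f.
Proof. by apply: eq_Rintegral => x _; rewrite mulrC. Qed.

Lemma ipDl f g h : L2 Omega f -> L2 Omega g -> L2 Omega h ->
  ip Omega (f \+ g) h = ip Omega f h + ip Omega g h.
Proof.
move=> Lf Lg Lh; rewrite /ip.
under eq_Rintegral do rewrite /= mulrDl.
by apply: RintegralD => //; exact: L2_integrableM.
Qed.

Lemma ipZl (a : R) f h : L2 Omega f -> L2 Omega h ->
  ip Omega (fun x => a * f x) h = a * ip Omega f h.
Proof.
move=> Lf Lh; rewrite /ip.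
under eq_Rintegral do rewrite /= -mulrA.
by apply: RintegralZl => //; exact: L2_integrableM.
Qed.

Lemma ipDr f g h : L2 Omega f -> L2 Omega g -> L2 Omega h ->
  ip Omega h (f \+ g) = ip Omega h f + ip Omega h g.
Proof. by move=> *; rewrite ipC ipDl// !(ipC h). Qed.

Lemma ipZr (a : R) f h : L2 Omega f -> L2 Omega h ->
  ip Omega h (fun x => a * f x) = a * ip Omega h f.
Proof. by move=> *; rewrite ipC ipZl// (ipC h). Qed.

Lemma ipBr f g h : L2 Omega f -> L2 Omega g -> L2 Omega h ->
  ip Omega h (f \- g) = ip Omega h f - ip Omega h g.
Proof.
move=> Lf Lg Lh; have -> : f \- g = f \+ (fun x => -1 * g x).
  by apply/funext => x /=; rewrite mulN1r.
by rewrite ipDr//; [rewrite ipZr// mulN1r|exact: L2Z].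
Qed.

Lemma ip0l h : ip Omega (fun=> 0) h = 0.
Proof.
by rewrite /ip; under eq_Rintegral do rewrite mul0r; rewrite Rintegral_cst// mul0r.
Qed.

Lemma ip_suml (I : Type) (r : seq I) (P : pred I) (F : I -> X -> R) h :
  (forall i, P i -> L2 Omega (F i)) -> L2 Omega h ->
  ip Omega (fun x => \sum_(i <- r | P i) F i x) h =
  \sum_(i <- r | P i) ip Omega (F i) h.
Proof.
move=> LF Lh; elim: r => [|i r IH].
  by under eq_fun do rewrite big_nil; rewrite big_nil ip0l.
rewrite big_cons; under eq_fun do rewrite big_cons.
case Pi: (P i) => //; rewrite -IH; apply: ipDl => //; first exact: LF.
exact: L2_sum.
Qed.

Lemma ip_sumr (I : Type) (r : seq I) (P : pred I) (F : I -> X -> R) h :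
  (forall i, P i -> L2 Omega (F i)) -> L2 Omega h ->
  ip Omega h (fun x => \sum_(i <- r | P i) F i x) =
  \sum_(i <- r | P i) ip Omega h (F i).
Proof.
by move=> LF Lh; rewrite ipC ip_suml//; apply: eq_bigr => i _; rewrite ipC.
Qed.

Lemma ip_ge0 f : 0 <= ip Omega f f.
Proof. by apply: Rintegral_ge0 => x _; rewrite -expr2 sqr_ge0. Qed.

Lemma norm0_ge0 f : 0 <= norm0 Omega f.
Proof. exact: sqrtr_ge0. Qed.

Lemma norm0_sqr f : norm0 Omega f ^+ 2 = ip Omega f f.
Proof. by rewrite sqr_sqrtr ?ip_ge0. Qed.

Lemma ip_sqr_lin f g (a b : R) : L2 Omega f -> L2 Omega g ->
  ip Omega (fun x => a * f x + b * g x) (fun x => a * f x + b * g x) =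
  a ^+ 2 * ip Omega f f + 2 * a * b * ip Omega f g + b ^+ 2 * ip Omega g g.
Proof.
move=> Lf Lg; have La := L2Z a Lf; have Lb := L2Z b Lg.
rewrite -/((fun x => a * f x) \+ (fun x => b * g x)).
rewrite ipDl//; last exact: L2D.
by rewrite !ipDr// !ipZl// !ipZr// (ipC g f); ring.
Qed.

(** The quadratic form of [ip_sqr_lin] is nonnegative; it is evaluated at coefficients ((g,g),
    -(f,g)). On representatives it is only semidefinite, so a zero norm of g, or of both functions,
    calls for other coefficients. *)
Lemma cauchy_schwarz f g : L2 Omega f -> L2 Omega g ->
  `|ip Omega f g| <= norm0 Omega f * norm0 Omega g.
Proof.
move=> Lf Lg.
have H (a b : R) : 0 <= a ^+ 2 * ip Omega f f + 2 * a * b * ip Omega f g +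
    b ^+ 2 * ip Omega g g by rewrite -ip_sqr_lin//; exact: ip_ge0.
rewrite -[leRHS]ger0_norm ?mulr_ge0 ?norm0_ge0// -ler_sqr ?nnegrE//.
rewrite !real_normK ?num_real// exprMn !norm0_sqr.
have := ip_ge0 g; rewrite le_eqVlt => /predU1P[g0|g0].
  have := ip_ge0 f; rewrite le_eqVlt => /predU1P[f0|f0].
    have := H 1 (- ip Omega f g); rewrite -f0 -g0 => h.
    by have := sqr_ge0 (ip Omega f g); lra.
  have := H (- ip Omega f g) (ip Omega f f); rewrite -g0 => h.
  rewrite mulr0 -(ler_pM2l f0) mulr0; move: h; rewrite sqrrN; lra.
have := H (ip Omega g g) (- ip Omega f g) => h.
rewrite -subr_ge0 -(pmulr_rge0 _ g0); move: h; rewrite sqrrN; lra.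
Qed.

Lemma ip_young f g : L2 Omega f -> L2 Omega g ->
  2 * ip Omega f g <= ip Omega f f + ip Omega g g.
Proof.
move=> Lf Lg; have := ip_ge0 (fun x => 1 * f x + -1 * g x).
by rewrite ip_sqr_lin// ; lra.
Qed.

Lemma test_function_L2 psi : test_function Omega psi -> L2 Omega psi.
Proof.
move=> [s [K [cK KO K0]]].
have mpsi := continuous_measurable_rV (smooth_continuous s).
have mO : measurable_fun Omega psi by exact: measurable_funTS.
split => //.
have mK := compact_measurable_rV cK.
rewrite integrable_mkcond//.
(* Integration moves from [Omega] to the support K, where psi^2 is bounded and the measure is
   finite. *)
have -> : (fun x => (psi x ^+ 2)%:E) \_ Omega = (EFin \o (psi ^+ 2)) \_ K.
  apply/funext => x; rewrite !patchE.
  have [xK|xK] := boolP (x \in K).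
    by rewrite mem_set//; apply/KO/set_mem.
  by case: ifP => //= _; rewrite K0 ?expr0n//; move/negP: xK; rewrite inE.
rewrite -integrable_mkcond//; apply: measurable_bounded_integrable => //.
- exact: compact_finite_measure_rV.
- by apply: (measurable_funX (f := psi) 2); exact: measurable_funTS.
have cpsi2 : continuous (psi ^+ 2)
  by move=> x; rewrite expr2; apply: continuousM; exact: smooth_continuous.
have [M [Mr HM]] : bounded_set ((psi ^+ 2) @` K).
  by apply: compact_bounded; apply: continuous_compact => //; exact: continuous_subspaceT.
by exists M; split => // y My x Kx; apply: HM => //; exists x.
Qed.

End L2_theory.

(** * Norm inequalities for functions and matrix fields *)

Section L2_norms.
Context {R : realType} {n : nat}.
Local Notation X := 'rV[R]_n.
Variable Omega : set X.
Hypothesis mOmega : measurable Omega.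
Implicit Types (f g : X -> R).

Lemma norm0D f g : L2 Omega f -> L2 Omega g ->
  norm0 Omega (f \+ g) <= norm0 Omega f + norm0 Omega g.
Proof.
move=> Lf Lg; rewrite -[leRHS]ger0_norm ?addr_ge0 ?norm0_ge0//.
rewrite -[leLHS]ger0_norm ?norm0_ge0// -ler_sqr ?nnegrE//.
rewrite !real_normK ?num_real// sqrrD !norm0_sqr.
have fgE : f \+ g = (fun x => 1 * f x + 1 * g x).
  by apply/funext => x; rewrite !mul1r.
have := cauchy_schwarz mOmega Lf Lg; rewrite ler_norml => /andP[_].
by rewrite fgE ip_sqr_lin//; lra.
Qed.

Lemma norm0Z (a : R) f : L2 Omega f ->
  norm0 Omega (fun x => a * f x) = `|a| * norm0 Omega f.
Proof.
move=> Lf; rewrite /norm0 ipZl//; last exact: L2Z.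
by rewrite ipZr// mulrA -expr2 sqrtrM ?sqr_ge0// sqrtr_sqr.
Qed.

Lemma norm0_lin (a b : R) f g : L2 Omega f -> L2 Omega g ->
  norm0 Omega (fun x => a * f x + b * g x) <=
  `|a| * norm0 Omega f + `|b| * norm0 Omega g.
Proof.
by move=> Lf Lg; rewrite -!norm0Z//; apply: norm0D; exact: L2Z.
Qed.

Context {p q : nat}.
Implicit Types F G : X -> 'M[R]_(p, q).

Lemma ipm_ge0 F : 0 <= ipm Omega F F.
Proof. by apply: sumr_ge0 => i _; apply: sumr_ge0 => j _; exact: ip_ge0. Qed.

Lemma norm0m_ge0 F : 0 <= norm0m Omega F.
Proof. exact: sqrtr_ge0. Qed.

Lemma norm0m_sqr F : norm0m Omega F ^+ 2 =
  \sum_i \sum_j norm0 Omega (fun x => F x i j) ^+ 2.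
Proof.
rewrite sqr_sqrtr ?ipm_ge0//.
by apply: eq_bigr => i _; apply: eq_bigr => j _; rewrite norm0_sqr.
Qed.

Lemma norm0_le_norm0m F i j : norm0 Omega (fun x => F x i j) <= norm0m Omega F.
Proof.
rewrite -[leRHS]ger0_norm ?norm0m_ge0// -[leLHS]ger0_norm ?norm0_ge0//.
rewrite -ler_sqr ?nnegrE// !real_normK ?num_real// norm0m_sqr.
rewrite (bigD1 i)//= (bigD1 j)//= -addrA lerDl addr_ge0//.
  by apply: sumr_ge0 => k _; exact: sqr_ge0.
by apply: sumr_ge0 => k _; apply: sumr_ge0 => l _; exact: sqr_ge0.
Qed.

End L2_norms.

(** * Sobolev spaces *)

Section Sobolev.
Context {R : realType} {n : nat}.
Local Notation X := 'rV[R]_n.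
Variable Omega : set X.
Hypothesis mOmega : measurable Omega.
Implicit Types (f g psi : X -> R) (Df Dg : X -> 'rV[R]_n).

Lemma H1_L2 f Df : H1 Omega f Df -> L2 Omega f.
Proof. by case. Qed.

Lemma H1_grad_L2 f Df k : H1 Omega f Df -> L2 Omega (fun x => Df x ord0 k).
Proof. by case=> _ + _; exact. Qed.

Lemma H1_lin (a b : R) f g Df Dg : H1 Omega f Df -> H1 Omega g Dg ->
  H1 Omega (fun x => a * f x + b * g x) (fun x => a *: Df x + b *: Dg x).
Proof.
move=> Hf Hg; have [Lf LDf wf] := Hf; have [Lg LDg wg] := Hg.
have E k : (fun x => (a *: Df x + b *: Dg x) ord0 k) =
    (fun x => a * Df x ord0 k) \+ (fun x => b * Dg x ord0 k).
  by apply/funext => x; rewrite !mxE.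
split.
- by apply: (L2D mOmega (L2Z mOmega a Lf) (L2Z mOmega b Lg)).
- move=> i k; rewrite ord1 E.
  exact: (L2D mOmega (L2Z mOmega a (LDf _ _)) (L2Z mOmega b (LDg _ _))).
- move=> k psi tpsi; rewrite E.
  have Lpsi := test_function_L2 mOmega tpsi.
  have LDpsi := test_function_L2 mOmega (test_function_partial k tpsi).
  rewrite -[X in ip _ X (partial _ _)]/((fun x => a * f x) \+ (fun x => b * g x)).
  rewrite !ipDl ?ipZl ?wf ?wg//; try exact: L2Z.
  by rewrite opprD !mulrN.
Qed.

(** Splits the joint norm of the definition into separate bounds for the function and each
    derivative; [H10_intro] is the converse. *)
Lemma H10_approx f Df (e : R) : H10 Omega f Df -> 0 < e ->
  exists psi, [/\ test_function Omega psi, norm0 Omega (f \- psi) < e &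
    forall k, norm0 Omega (fun x => Df x ord0 k - partial k psi x) < e].
Proof.
move=> [_ H] /H[psi tpsi He]; exists psi.
have sq : 0 <= norm0 Omega (f \- psi) ^+ 2 + norm0m Omega (Df \- grad psi) ^+ 2.
  by rewrite addr_ge0 ?sqr_ge0.
split=> //.
  apply: le_lt_trans He; rewrite -[leLHS]ger0_norm ?norm0_ge0// -sqrtr_sqr.
  by rewrite ler_sqrt// lerDl sqr_ge0.
move=> k; apply: le_lt_trans He.
have -> : (fun x => Df x ord0 k - partial k psi x) =
    (fun x => (Df \- grad psi) x ord0 k) by apply/funext => x; rewrite !mxE.
apply: le_trans (norm0_le_norm0m _ _ _ _) _.
rewrite -[leLHS]ger0_norm ?norm0m_ge0// -sqrtr_sqr.
by rewrite ler_sqrt// lerDr sqr_ge0.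
Qed.

Lemma H10_intro f Df : H1 Omega f Df ->
  (forall e : R, 0 < e -> exists psi, [/\ test_function Omega psi,
    norm0 Omega (f \- psi) < e &
    forall k, norm0 Omega (fun x => Df x ord0 k - partial k psi x) < e]) ->
  H10 Omega f Df.
Proof.
move=> Hf H; split => // e e0.
(* The squared norm has n + 1 terms, each at most d^2, and n + 1 < (n + 2)^2. *)
have d0 : 0 < e / n.+2%:R by rewrite divr_gt0.
have [psi [tpsi fpsi dpsi]] := H _ d0; exists psi => //.
set d := e / _ in d0 fpsi dpsi.
rewrite -[ltRHS]ger0_norm ?ltW// -sqrtr_sqr ltr_sqrt ?exprn_gt0//.
have le_d x : 0 <= x -> x < d -> x ^+ 2 <= d ^+ 2.
  by move=> x0 /ltW xd; rewrite ler_sqr ?nnegrE// ltW.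
apply: (@le_lt_trans _ _ (d ^+ 2 *+ n.+1)).
  rewrite mulrS lerD ?le_d ?norm0_ge0// norm0m_sqr big_ord1.
  rewrite -[X in _ *+ X]card_ord -sumr_const; apply: ler_sum => k _.
  rewrite le_d ?norm0_ge0//; apply: le_lt_trans (dpsi k).
  by under [X in norm0 _ X <= _]eq_fun do rewrite !mxE.
have -> : e = d *+ n.+2 by rewrite -mulr_natr /d divfK// pnatr_eq0.
rewrite exprMn_n ltr_pMn2l ?exprn_gt0//.
by rewrite -[X in (X < _)%N]muln1 ltn_mul.
Qed.

Lemma H10_lin (a b : R) f g Df Dg : H10 Omega f Df -> H10 Omega g Dg ->
  H10 Omega (fun x => a * f x + b * g x) (fun x => a *: Df x + b *: Dg x).
Proof.
move=> Hf Hg; have [H1f _] := Hf; have [H1g _] := Hg.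
apply: H10_intro; first exact: H1_lin.
(* The added 1 covers a = b = 0 and makes the final estimate strict. *)
move=> e e0; pose d := e / (`|a| + `|b| + 1).
have ab : 0 < `|a| + `|b| + 1 by rewrite ltr_wpDl ?addr_ge0.
have d0 : 0 < d by rewrite divr_gt0.
have key u v : 0 <= u -> u < d -> 0 <= v -> v < d -> `|a| * u + `|b| * v < e.
  move=> u0 ud v0 vd; have -> : e = `|a| * d + `|b| * d + d.
    by rewrite -!mulrDl -[X in _ + X]mul1r -mulrDl /d mulrC divfK// gt_eqF.
  have := ler_wpM2l (normr_ge0 a) (ltW ud).
  by have := ler_wpM2l (normr_ge0 b) (ltW vd); have := d0; lra.
have [psi [tpsi fpsi dpsi]] := H10_approx Hf d0.
have [phi [tphi gphi dphi]] := H10_approx Hg d0.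
have LD F G : L2 Omega F -> test_function Omega G -> L2 Omega (F \- G).
  by move=> LF /(test_function_L2 mOmega); exact: L2B.
exists ((fun x => a * psi x) \+ (fun x => b * phi x)); split.
- by apply: test_functionD; exact: test_functionZ.
- apply: le_lt_trans (key _ _ (norm0_ge0 _ _) fpsi (norm0_ge0 _ _) gphi).
  apply: le_trans (norm0_lin mOmega a b (LD _ _ (H1_L2 H1f) tpsi)
    (LD _ _ (H1_L2 H1g) tphi)).
  by rewrite le_eqVlt; apply/predU1P; left; congr norm0; apply/funext => x /=; ring.
- move=> k; apply: le_lt_trans (key _ _ (norm0_ge0 _ _) (dpsi k)
    (norm0_ge0 _ _) (dphi k)).
  apply: le_trans (norm0_lin mOmega a b
    (LD _ _ (H1_grad_L2 k H1f) (test_function_partial k tpsi))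
    (LD _ _ (H1_grad_L2 k H1g) (test_function_partial k tphi))).
  have [spsi _] := tpsi; have [sphi _] := tphi.
  rewrite le_eqVlt; apply/predU1P; left; congr norm0.
  apply/funext => x; rewrite partialD; try exact: smoothZ.
  by rewrite !partialZ// !mxE /=; ring.
Qed.

(** By Cauchy-Schwarz the functional is continuous in the H^1 norm, and test functions are dense in
    H^1_0. *)
Lemma H10_closure f Df (a : X -> R) (b : 'I_n -> X -> R) :
  L2 Omega a -> (forall k, L2 Omega (b k)) ->
  (forall psi, test_function Omega psi ->
    ip Omega a psi + \sum_k ip Omega (b k) (partial k psi) = 0) ->
  H10 Omega f Df ->
  ip Omega a f + \sum_k ip Omega (b k) (fun x => Df x ord0 k) = 0.
Proof.
move=> La Lb H Hf; have [H1f _] := Hf; apply/eqP; rewrite -normr_eq0.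
apply/eqP/le_anti; rewrite normr_ge0 andbT.
apply/ler_addgt0Pr => e e0; rewrite add0r.
(* C bounds the functional; approximation within e / (C + 1) leaves an error of at most e, also for
   C = 0. *)
pose C := norm0 Omega a + \sum_k norm0 Omega (b k).
have C0 : 0 <= C by rewrite addr_ge0 ?norm0_ge0// sumr_ge0// => k _; exact: norm0_ge0.
have C1 : 0 < C + 1 by rewrite ltr_wpDl.
have d0 : 0 < e / (C + 1) by rewrite divr_gt0.
have [psi [tpsi fpsi dpsi]] := H10_approx Hf d0.
have Lpsi := test_function_L2 mOmega tpsi.
have LDpsi k := test_function_L2 mOmega (test_function_partial k tpsi).
have -> : ip Omega a f + \sum_k ip Omega (b k) (fun x => Df x ord0 k) =
    ip Omega a (f \- psi) +
    \sum_k ip Omega (b k) ((fun x => Df x ord0 k) \- partial k psi).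
  rewrite ipBr//; last exact: (H1_L2 H1f).
  rewrite [in RHS](eq_bigr _ (fun k _ =>
    ipBr mOmega (H1_grad_L2 k H1f) (LDpsi k) (Lb k))).
  by rewrite sumrB addrACA -opprD H// subr0.
apply: (@le_trans _ _ (C * (e / (C + 1)))).
  apply: le_trans (ler_normD _ _) _; rewrite mulrDl mulr_suml lerD//.
    apply: le_trans (cauchy_schwarz mOmega La (L2B mOmega (H1_L2 H1f) Lpsi)) _.
    by rewrite ler_wpM2l ?norm0_ge0 ?ltW.
  apply: le_trans (ler_norm_sum _ _ _) _; apply: ler_sum => k _.
  apply: le_trans (cauchy_schwarz mOmega (Lb k)
    (L2B mOmega (H1_grad_L2 k H1f) (LDpsi k))) _.
  exact: ler_wpM2l (norm0_ge0 _ _) _ _ (ltW (dpsi k)).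
rewrite mulrCA ger_pMr// ler_pdivrMr// mul1r; lra.
Qed.

(* Testing the weak derivative against [partial j psi] replaces the integration
   by parts. *)
Lemma H10_grad_swap f g Df Dg i j : H1 Omega f Df -> H10 Omega g Dg ->
  ip Omega (fun x => Df x ord0 i) (fun x => Dg x ord0 j) =
  ip Omega (fun x => Df x ord0 j) (fun x => Dg x ord0 i).
Proof.
move=> Hf Hg; have [_ _ wf] := Hf; have [H1g _] := Hg.
have LDf k := H1_grad_L2 k Hf.
(* The coefficients place D_i f in slot j and - D_j f in slot i, so that the functional is the
   difference of the two sides. *)
pose b k (x : X) : R := (k == j)%:R * Df x ord0 i + (- (k == i)%:R) * Df x ord0 j.
have Lb k : L2 Omega (b k).
  exact: (L2D mOmega (L2Z mOmega _ (LDf i)) (L2Z mOmega _ (LDf j))).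
have delta (k : 'I_n) (F : 'I_n -> R) : \sum_l (l == k)%:R * F l = F k.
  rewrite (bigD1 k)//= eqxx mul1r big1 ?addr0// => l /negPf ->.
  by rewrite mul0r.
have ipb (F : 'I_n -> X -> R) : (forall k, L2 Omega (F k)) ->
    \sum_k ip Omega (b k) (F k) =
    ip Omega (fun x => Df x ord0 i) (F j) - ip Omega (fun x => Df x ord0 j) (F i).
  move=> LF; rewrite -(delta j (fun k => ip Omega (fun x => Df x ord0 i) (F k))).
  rewrite -(delta i (fun k => ip Omega (fun x => Df x ord0 j) (F k))) -sumrB.
  apply: eq_bigr => k _; rewrite -mulNr -!ipZl//.
  by rewrite -ipDl//; exact: L2Z.
have L0 : L2 Omega (fun=> 0).
  by have := L2Z mOmega 0 (LDf i); under eq_fun do rewrite mul0r.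
have tests psi : test_function Omega psi ->
    ip Omega (fun=> 0) psi + \sum_k ip Omega (b k) (partial k psi) = 0.
  move=> tpsi; have tD k := test_function_partial k tpsi; have [spsi _] := tpsi.
  have E k l : ip Omega (fun x => Df x ord0 k) (partial l psi) =
      - ip Omega f (partial k (partial l psi)) by rewrite wf ?opprK.
  rewrite ip0l// add0r ipb => [|k]; last exact: test_function_L2.
  by rewrite !E (partialC i j spsi) subrr.
have := H10_closure L0 Lb tests Hg.
rewrite ip0l// add0r ipb => [|k]; last exact: (H1_grad_L2 k H1g).
by move/eqP; rewrite subr_eq0 => /eqP.
Qed.

End Sobolev.

(** * Symmetrized tensors *)

Section tensors.
Context {R : realType} {n : nat}.
Local Notation X := 'rV[R]_n.
Variable Omega : set X.
Hypothesis mOmega : measurable Omega.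
Implicit Types (tau phi : X -> 'M[R]_n).
Implicit Types (Dtau Dphi : 'I_n -> 'I_n -> X -> 'rV[R]_n).

Definition tensor_div Dtau : X -> 'rV[R]_n :=
  fun x => \row_i \sum_j Dtau i j x ord0 j.

(** The sign cancels the one in [dist_partial]. *)
Definition neg_sym phi : X -> 'M[R]_n := fun x => - 2^-1 *: (phi x + (phi x)^T).

Definition neg_sym_grad Dphi i j : X -> 'rV[R]_n :=
  fun x => - 2^-1 *: Dphi i j x + - 2^-1 *: Dphi j i x.

Lemma tensor_divE Dtau i : (fun x => tensor_div Dtau x ord0 i) =
  (fun x => \sum_j Dtau i j x ord0 j).
Proof. by apply/funext => x; rewrite mxE. Qed.

Lemma neg_sym_H10 phi Dphi : H10_tensor Omega phi Dphi ->
  H10_tensor Omega (neg_sym phi) (neg_sym_grad Dphi).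
Proof.
move=> H i j; have -> : (fun x => neg_sym phi x i j) =
    (fun x => - 2^-1 * phi x i j + - 2^-1 * phi x j i).
  by apply/funext => x; rewrite !mxE mulrDr.
exact: H10_lin.
Qed.

Lemma ip_neg_sym_grad f Dphi i j k : L2 Omega f ->
  (forall i j k, L2 Omega (fun x => Dphi i j x ord0 k)) ->
  ip Omega (fun x => neg_sym_grad Dphi i j x ord0 k) f =
  - 2^-1 * ip Omega (fun x => Dphi i j x ord0 k) f
  - 2^-1 * ip Omega (fun x => Dphi j i x ord0 k) f.
Proof.
move=> Lf LD.
have -> : (fun x => neg_sym_grad Dphi i j x ord0 k) =
    (fun x => - 2^-1 * Dphi i j x ord0 k) \+ (fun x => - 2^-1 * Dphi j i x ord0 k).
  by apply/funext => x; rewrite !mxE.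
rewrite ipDl ?ipZl ?mulNr//; exact: L2Z.
Qed.

(** * Tensors with entries in H^1_0: normal trace and norm estimates *)

Section H10_tensor.
Variables (tau : X -> 'M[R]_n) (Dtau : 'I_n -> 'I_n -> X -> 'rV[R]_n).
Hypothesis Htau : H10_tensor Omega tau Dtau.

Lemma tensor_L2 i j : L2 Omega (fun x => tau x i j).
Proof. by have [H _] := Htau i j; exact: (H1_L2 H). Qed.

Lemma tensor_grad_L2 i j k : L2 Omega (fun x => Dtau i j x ord0 k).
Proof. by have [H _] := Htau i j; exact: (H1_grad_L2 k H). Qed.

Lemma tensor_div_L2 : L2m Omega (tensor_div Dtau).
Proof.
move=> i j; rewrite ord1 tensor_divE; apply: L2_sum => // k _.
exact: tensor_grad_L2.
Qed.

Lemma ip_tensor_div f i : L2 Omega f ->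
  ip Omega (fun x => tensor_div Dtau x ord0 i) f =
  \sum_j ip Omega (fun x => Dtau i j x ord0 j) f.
Proof.
move=> Lf; rewrite tensor_divE ip_suml// => j _; exact: tensor_grad_L2.
Qed.

Lemma H10_tensor_Sigma : (forall x, (tau x)^T = tau x) ->
  Sigma_space Omega tau (tensor_div Dtau).
Proof.
move=> sym; split.
- exact: tensor_L2.
- exact: tensor_div_L2.
- move=> i psi tpsi; rewrite ip_tensor_div; last exact: test_function_L2.
  rewrite -sumrN; apply: eq_bigr => j _.
  by have [[_ _ ->]] := Htau i j.
- by apply: aeW => x _; exact: sym.
Qed.

(** Green's formula holds separately for each pair i, j: (D_j w_i, psi) + (w_i, d_j psi) = 0 for
    test functions is the definition of the weak derivative of w_i, and it extends to psi = tau_ij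
    by closure. *)
Lemma H10_tensor_Sigma_tilde : (forall x, (tau x)^T = tau x) ->
  Sigma_tilde Omega tau (tensor_div Dtau).
Proof.
move=> sym; split; first exact: H10_tensor_Sigma.
move=> w Dw Hw; rewrite /normal_trace /ipm big_ord1.
rewrite -big_split/= big1// => i _.
have Lw := H1_L2 (Hw i).
rewrite ip_tensor_div// -big_split/= big1// => j _.
have [_ LDw ww] := Hw i.
have LDwij : L2 Omega (fun x => Dw x i j).
  by have := LDw ord0 j; under eq_fun do rewrite mxE.
pose b k : X -> R := fun x => (k == j)%:R * w x ord0 i.
have Lb k : L2 Omega (b k) by exact: L2Z.
have ipb (F : 'I_n -> X -> R) : (forall k, L2 Omega (F k)) ->
    \sum_k ip Omega (b k) (F k) = ip Omega (fun x => w x ord0 i) (F j).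
  move=> LF; rewrite (bigD1 j)//= ipZl// eqxx mul1r big1 ?addr0// => k /negPf kj.
  by rewrite ipZl// kj mul0r.
have tests psi : test_function Omega psi ->
    ip Omega (fun x => Dw x i j) psi + \sum_k ip Omega (b k) (partial k psi) = 0.
  move=> tpsi; rewrite ipb => [|k]; last first.
    exact/test_function_L2/test_function_partial.
  rewrite (ww j psi tpsi); under [X in - ip _ X _]eq_fun do rewrite mxE.
  by rewrite subrr.
have := H10_closure mOmega LDwij Lb tests (Htau i j).
rewrite ipb => [|k]; last exact: tensor_grad_L2.
by rewrite ipC [X in _ + X]ipC.
Qed.

Lemma seminorm1_tensor_sqr : seminorm1_tensor Omega Dtau ^+ 2 =
  \sum_i \sum_j \sum_k
    ip Omega (fun x => Dtau i j x ord0 k) (fun x => Dtau i j x ord0 k).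
Proof.
rewrite sqr_sqrtr; last first.
  by apply: sumr_ge0 => i _; apply: sumr_ge0 => j _; exact: sqr_ge0.
apply: eq_bigr => i _; apply: eq_bigr => j _.
by rewrite norm0m_sqr big_ord1; apply: eq_bigr => k _; rewrite norm0_sqr.
Qed.

Lemma norm_tensor_div_le :
  norm0m Omega (tensor_div Dtau) ^+ 2 <= seminorm1_tensor Omega Dtau ^+ 2.
Proof.
rewrite seminorm1_tensor_sqr norm0m_sqr big_ord1; apply: ler_sum => i _.
have LD := tensor_grad_L2.
rewrite norm0_sqr ip_tensor_div; last exact: tensor_div_L2.
pose G j k l m := ip Omega (fun x => Dtau i j x ord0 k) (fun x => Dtau i l x ord0 m).
have -> : \sum_j ip Omega (fun x => Dtau i j x ord0 j)
    (fun x => tensor_div Dtau x ord0 i) = \sum_j \sum_k G j k k j.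
  apply: eq_bigr => j _; rewrite tensor_divE ip_sumr//; apply: eq_bigr => k _.
  by have [H1ij _] := Htau i j; exact: (H10_grad_swap mOmega j k H1ij (Htau i k)).
(* The squared seminorm is symmetrized in j and k, so that Young's inequality applies term by
   term. *)
have -> : \sum_j \sum_k ip Omega (fun x => Dtau i j x ord0 k)
      (fun x => Dtau i j x ord0 k) =
    2^-1 * \sum_j \sum_k (G j k j k + G k j k j).
  under [in RHS]eq_bigr => j _ do rewrite big_split/=.
  by rewrite big_split/= [X in _ + X]exchange_big/= /G; lra.
rewrite mulr_sumr; apply: ler_sum => j _; rewrite mulr_sumr; apply: ler_sum => k _.
by rewrite ler_pdivlMl//; exact: ip_young.
Qed.

Lemma norm0m_tensor_le (C : R) : 0 <= C ->
  (forall i j, norm0 Omega (fun x => tau x i j) <= C * norm0m Omega (Dtau i j)) ->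
  norm0m Omega tau ^+ 2 <= C ^+ 2 * seminorm1_tensor Omega Dtau ^+ 2.
Proof.
move=> C0 H; rewrite norm0m_sqr sqr_sqrtr; last first.
  by apply: sumr_ge0 => i _; apply: sumr_ge0 => j _; exact: sqr_ge0.
rewrite mulr_sumr; apply: ler_sum => i _; rewrite mulr_sumr; apply: ler_sum => j _.
by rewrite -exprMn ler_sqr ?nnegrE ?mulr_ge0 ?norm0_ge0 ?norm0m_ge0.
Qed.

(** For a null entry f, (D_k f, d_k psi) = - (f, d_k d_k psi) = 0. By closure psi may be replaced by
    f itself, which gives sum_k (D_k f, D_k f) = 0. *)
Lemma norm0m_tensor_eq0 : norm0m Omega tau = 0 ->
  seminorm1_tensor Omega Dtau = 0.
Proof.
move=> tau0; apply/eqP; rewrite -sqrf_eq0 seminorm1_tensor_sqr; apply/eqP.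
rewrite big1// => i _; rewrite big1// => j _.
have tij : norm0 Omega (fun x => tau x i j) = 0.
  apply/le_anti; rewrite norm0_ge0 andbT.
  by have := norm0_le_norm0m Omega tau i j; rewrite tau0.
have L0 : L2 Omega (fun=> 0).
  by have := L2Z mOmega 0 (tensor_L2 i j); under eq_fun do rewrite mul0r.
have tests psi : test_function Omega psi -> ip Omega (fun=> 0) psi +
    \sum_k ip Omega (fun x => Dtau i j x ord0 k) (partial k psi) = 0.
  move=> tpsi; rewrite ip0l// add0r big1// => k _.
  have [[_ _ w] _] := Htau i j; have tk := test_function_partial k tpsi.
  rewrite -[LHS]opprK -(w k _ tk); apply/eqP; rewrite oppr_eq0.
  rewrite -normr_le0; apply: le_trans (cauchy_schwarz mOmega _ _) _.
  - exact: tensor_L2.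
  - exact/test_function_L2/test_function_partial.
  - by rewrite tij mul0r.
have := H10_closure mOmega L0 (tensor_grad_L2 i j) tests (Htau i j).
by rewrite ip0l// add0r.
Qed.

End H10_tensor.

(** Symmetrization is a contraction: |(a + b) / 2|^2 is at most (|a|^2 + |b|^2) / 2, and the sum
    over i, j is invariant under transposition. *)
Lemma seminorm1_neg_sym phi Dphi : H10_tensor Omega phi Dphi ->
  seminorm1_tensor Omega (neg_sym_grad Dphi) ^+ 2 <=
  seminorm1_tensor Omega Dphi ^+ 2.
Proof.
move=> H; have LD := tensor_grad_L2 H.
rewrite !seminorm1_tensor_sqr.
pose G i j k := ip Omega (fun x => Dphi i j x ord0 k) (fun x => Dphi i j x ord0 k).
have -> : \sum_i \sum_j \sum_k ip Omega (fun x => Dphi i j x ord0 k)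
      (fun x => Dphi i j x ord0 k) =
    \sum_i \sum_j 2^-1 * (\sum_k G i j k + \sum_k G j i k).
  under [RHS]eq_bigr => i _ do rewrite -mulr_sumr big_split/=.
  by rewrite -mulr_sumr big_split/= [X in _ + X]exchange_big/= /G; lra.
apply: ler_sum => i _; apply: ler_sum => j _.
rewrite -big_split/= mulr_sumr; apply: ler_sum => k _.
have -> : (fun x => neg_sym_grad Dphi i j x ord0 k) =
    (fun x => - 2^-1 * Dphi i j x ord0 k + - 2^-1 * Dphi j i x ord0 k).
  by apply/funext => x; rewrite !mxE.
rewrite ip_sqr_lin//; have := ip_young mOmega (LD i j k) (LD j i k).
by rewrite /G; lra.
Qed.

Lemma sym_grad_tensor_div v phi Dphi : L2m Omega v -> H10_tensor Omega phi Dphi ->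
  sym_grad Omega v phi Dphi = ipm Omega (tensor_div (neg_sym_grad Dphi)) v.
Proof.
move=> Lv H; have LD := tensor_grad_L2 H.
rewrite /ipm big_ord1 /sym_grad /dist_partial.
pose G i j k := ip Omega (fun x => Dphi i j x ord0 k) (fun x => v x ord0 i).
pose G' i j k := ip Omega (fun x => Dphi j i x ord0 k) (fun x => v x ord0 i).
(* Renaming i and j in the second half moves the transposition from the gradient of v to phi. *)
transitivity (\sum_i \sum_j - 2^-1 * G i j j + \sum_i \sum_j - 2^-1 * G' i j j).
  rewrite [X in _ + X]exchange_big/= -big_split/=; apply: eq_bigr => i _.
  rewrite -big_split/=; apply: eq_bigr => j _.
  rewrite /G /G' (ipC _ (fun x => v x ord0 i)) (ipC _ (fun x => v x ord0 j)).
  by ring.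
rewrite -big_split/=; apply: eq_bigr => i _.
rewrite (ip_tensor_div (neg_sym_H10 H)); last exact: Lv.
rewrite -big_split/=; apply: eq_bigr => j _.
rewrite (ip_neg_sym_grad _ _ _ (Lv ord0 i) LD).
by rewrite /G /G'; ring.
Qed.

End tensors.

(** * The inf-sup bound *)

Lemma ipm_eq0 (R : realType) (n p q : nat) (Omega : set 'rV[R]_n)
    (F G : 'rV[R]_n -> 'M[R]_(p, q)) : measurable Omega ->
  L2m Omega F -> L2m Omega G -> norm0m Omega F = 0 -> ipm Omega F G = 0.
Proof.
move=> mOmega LF LG F0; rewrite /ipm big1// => i _; rewrite big1// => j _.
apply/eqP; rewrite -normr_le0.
apply: le_trans (cauchy_schwarz mOmega (LF i j) (LG i j)) _.
have := norm0_le_norm0m Omega F i j; rewrite F0 => F0'.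
have -> : norm0 Omega (fun x => F x i j) = 0.
  by apply/le_anti; rewrite norm0_ge0 F0'.
by rewrite mul0r.
Qed.

(** Needed to cancel the factor [diam^-1]. The ball lies in [Omega], and the points c and c + (rho /
    2) e_0 are at distance rho / 2. *)
Lemma diameter_gt0 (R : realType) (n : nat) (Omega : set 'rV[R]_n)
    (diam rho : R) (c : 'rV[R]_n) : (0 < n)%N -> Omega !=set0 -> 0 < rho ->
  star_shaped Omega (eball c rho) -> diameter Omega = diam%:E -> 0 < diam.
Proof.
case: n Omega c => // n Omega c _ [x0 Ox0] rho0 star hd.
have ball_sub y : eball c rho y -> Omega y.
  (* The parameter t = 1 gives the end point y of the segment. *)
  move=> yB; have := star x0 y Ox0 yB 1; rewrite ler01 lexx scale1r.
  by rewrite addrCA subrr addr0; exact.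
have e0 : enorm ('e_ord0 : 'rV[R]_n.+1) = 1.
  rewrite /enorm (bigD1 ord0)//= big1 ?addr0 => [|i i0].
    by rewrite mxE eqxx expr1n sqrtr1.
  by rewrite mxE (negPf i0) expr0n.
have eZ (a : R) : 0 <= a -> enorm (a *: ('e_ord0 : 'rV[R]_n.+1)) = a.
  move=> a0; rewrite -[RHS]mulr1 -[in RHS]e0 /enorm.
  rewrite -[a in RHS]ger0_norm// -sqrtr_sqr -sqrtrM ?sqr_ge0// mulr_sumr.
  by congr Num.sqrt; apply: eq_bigr => i _; rewrite mxE exprMn.
have Oc : Omega c.
  by apply: ball_sub; rewrite /eball/= subrr -(scale0r 'e_ord0) eZ.
have rho2 : 0 < rho / 2 by rewrite divr_gt0.
have Od : Omega (c + (rho / 2) *: 'e_ord0).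
  apply: ball_sub; rewrite /eball/= addrAC subrr add0r eZ ?ltW//.
  by rewrite ltr_pdivrMr// ltr_pMr// ltr1n.
rewrite -lte_fin -hd; apply: (@lt_le_trans _ _ (rho / 2)%:E); first by rewrite lte_fin.
apply: ereal_sup_ubound; exists (c + (rho / 2) *: 'e_ord0) => //; exists c => //.
by rewrite addrAC subrr add0r eZ ?ltW.
Qed.

Lemma norm_Sigma_neg_sym (R : realType) (n : nat) (Omega : set 'rV[R]_n)
    (diam C_P : R) phi Dphi : measurable Omega -> 0 <= diam -> 0 <= C_P ->
  (forall f Df, H10 Omega f Df -> norm0 Omega f <= C_P * diam * norm0m Omega Df) ->
  H10_tensor Omega phi Dphi ->
  norm_Sigma Omega diam (neg_sym phi) (tensor_div (neg_sym_grad Dphi)) <=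
  diam * Num.sqrt (1 + C_P ^+ 2) * seminorm1_tensor Omega Dphi.
Proof.
move=> mOmega d0 CP0 poincare H; have Ht := neg_sym_H10 mOmega H.
rewrite -[leRHS]ger0_norm ?mulr_ge0 ?sqrtr_ge0// -sqrtr_sqr ler_sqrt ?sqr_ge0//.
rewrite !exprMn [Num.sqrt (1 + _) ^+ 2]sqr_sqrtr ?addr_ge0 ?sqr_ge0//.
have A := norm0m_tensor_le (mulr_ge0 CP0 d0) (fun i j => poincare _ _ (Ht i j)).
have B := norm_tensor_div_le mOmega Ht.
have C := seminorm1_neg_sym mOmega H.
apply: le_trans (lerD (le_trans A (ler_wpM2l (sqr_ge0 _) C))
                      (ler_wpM2l (sqr_ge0 diam) (le_trans B C))) _.
by rewrite le_eqVlt; apply/predU1P; left; rewrite exprMn; ring.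
Qed.

Theorem proposition1p5 (R : realType) (n : nat) (hn : n = 2%N \/ n = 3%N)
  (Omega : set 'rV[R]_n) (diam : R) (c : 'rV[R]_n) (rho : R)
  (hOmega : domain Omega) (hdiam : diameter Omega = diam%:E)
  (hrho : 0 < rho) (hstar : star_shaped Omega (eball c rho))
  (Cstar : R) (hCstar : 0 < Cstar)
  (hproj : forall v r : 'rV[R]_n -> 'rV[R]_n,
     L2m Omega v -> is_proj_RM Omega v r ->
     ((norm0m Omega (v \- r))%:E <=
      Cstar%:E * norm_Hm1_tensor Omega (sym_grad Omega v))%E)
  (C_P : R) (hC_P : 0 < C_P)
  (hpoincare : forall (f : 'rV[R]_n -> R) (Df : 'rV[R]_n -> 'rV[R]_n),
     H10 Omega f Df -> norm0 Omega f <= C_P * diam * norm0m Omega Df)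
  (beta0 : \bar R)
  (hbeta0 : (beta0 * (diam^-1)%:E)%E = inf_sup Omega diam) :
  ((Cstar^-1 * (Num.sqrt (1 + C_P ^+ 2))^-1)%:E <= beta0)%E.
Proof.
have [oOmega _ Omega0] := hOmega.
have mOmega := open_measurable_rV oOmega.
have n0 : (0 < n)%N by case: hn => ->.
have d0 : 0 < diam := diameter_gt0 n0 Omega0 hrho hstar hdiam.
set s := Num.sqrt _.
have s0 : 0 < s by rewrite sqrtr_gt0 ltr_wpDr ?sqr_ge0.
(* The claimed bound divided by the diameter, to be compared with [inf_sup] itself. *)
pose t := Cstar^-1 * s^-1 * diam^-1.
have t0 : 0 < t by rewrite !mulr_gt0 ?invr_gt0.
suff Ht : (t%:E <= inf_sup Omega diam)%E.
  rewrite -(@lee_pmul2r _ (diam^-1)%:E)// ?lte_fin ?invr_gt0//.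
  by rewrite hbeta0 -EFinM.
apply: le_ereal_inf_tmp => _ [v [[Lv projv] v0 ->]].
have N0 : 0 < norm0m Omega v by rewrite lt0r v0 norm0m_ge0.
have := hproj v _ Lv projv.
have -> : v \- (fun=> 0) = v by apply/funext => x /=; rewrite subr0.
set N := norm0m Omega v in N0 *; set S := norm_Hm1_tensor _ _ => NS.
apply/lee_subgt0Pr => e e0.
(* Strictness u < t makes the next threshold lie below the supremum; t / 2 keeps u positive when e
   is large. *)
have [u [u0 ut eu]] : exists u, [/\ 0 < u, u < t & t - e <= u].
  exists (Num.max (t - e) (t / 2)); split.
  - by rewrite lt_max divr_gt0 ?orbT.
  - by rewrite gt_max ltrBlDr ltrDl e0 /= ltr_pdivrMr// ltr_pMr// ltr1n.
  - by rewrite le_max lexx.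
apply: (@le_trans _ _ u%:E); first by rewrite -EFinB lee_fin.
(* Otherwise [hproj] would give N <= N (u / t) < N. *)
have : ((N * u * diam * s)%:E < S)%E.
  rewrite ltNge; apply/negP => SN.
  have C0 : (0 <= Cstar%:E)%E by rewrite lee_fin ltW.
  have := le_trans NS (@lee_wpmul2l _ _ C0 _ _ SN).
  rewrite -EFinM lee_fin leNgt => /negP; apply.
  have -> : Cstar * (N * u * diam * s) = N * (u / t).
    by rewrite /t; field; rewrite !gt_eqF.
  by rewrite gtr_pMr// ltr_pdivrMr// mul1r.
move=> /ereal_sup_gt[_ [phi [Dphi [Hphi phi0 ->]]]]; rewrite lte_fin => Ly.
have w0 : 0 < N * u * diam * s by rewrite !mulr_gt0.
(* A zero seminorm would make the quotient 0 by the convention for inverses, contradicting its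
   positive lower bound. *)
have sig0 : 0 < seminorm1_tensor Omega Dphi.
  rewrite lt0r sqrtr_ge0 andbT; apply/eqP => E.
  by move: (lt_trans w0 Ly); rewrite E invr0 mulr0 ltxx.
move: Ly; rewrite ltr_pdivlMr// => Ly.
pose tau := neg_sym phi; pose d := tensor_div (neg_sym_grad Dphi).
have Htau : H10_tensor Omega tau (neg_sym_grad Dphi) := neg_sym_H10 mOmega Hphi.
have LE : sym_grad Omega v phi Dphi = ipm Omega d v.
  exact: sym_grad_tensor_div.
rewrite LE in Ly.
have L0 : 0 < ipm Omega d v by apply: lt_trans Ly; rewrite mulr_gt0.
(* A nonzero phi may be antisymmetric, so this rests on (div tau, v) > 0: a null tau has zero
   seminorm, hence zero divergence and zero pairing with v. *)
have tau0 : norm0m Omega tau != 0.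
  apply/eqP => E; have sig := norm0m_tensor_eq0 mOmega Htau E.
  have := norm_tensor_div_le mOmega Htau; rewrite sig expr0n/= => dle.
  have dn0 : norm0m Omega d = 0.
    by apply/eqP; rewrite -sqrf_eq0; apply/eqP/le_anti; rewrite dle sqr_ge0.
  by move: L0; rewrite (ipm_eq0 mOmega (tensor_div_L2 mOmega Htau) Lv dn0) ltxx.
have Nt0 : 0 < norm_Sigma Omega diam tau d.
  rewrite /norm_Sigma sqrtr_gt0; apply: ltr_wpDr; first by rewrite mulr_ge0 ?sqr_ge0.
  by rewrite exprn_gt0// lt0r tau0 norm0m_ge0.
have Ntle : norm_Sigma Omega diam tau d <= diam * s * seminorm1_tensor Omega Dphi.
  by apply: norm_Sigma_neg_sym => //; exact: ltW.
(* The pairing exceeds N u [diam] s |phi|_1, which is at least N u times the norm of tau in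
   Sigma. *)
apply: (@le_trans _ _ (ipm Omega d v / (norm_Sigma Omega diam tau d * N))%:E).
  rewrite lee_fin ler_pdivlMr ?mulr_gt0//; apply: le_trans (ltW Ly).
  have Nu : 0 <= N * u by rewrite mulr_ge0 ?ltW.
  by have := ler_wpM2l Nu Ntle; lra.
apply: ereal_sup_ubound; exists tau, d; split => //.
apply: H10_tensor_Sigma_tilde => // x.
by rewrite /tau /neg_sym linearZ/= linearD/= trmxK addrC.
Qed.
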